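(* Let $\kappa>0$, $n\ge2$, and let $\mathcal Z(\boldsymbol\theta)$ be a partition function of a multiple radial SLE($\kappa$) system, satisfying for some constant $h$ $$\mathcal L_j\mathcal Z=h\mathcal Z,\qquad j=1,\dots,n,$$ where $$\mathcal L_j=\frac\kappa2\partial_j^2+\sum_{k\ne j}\left(\cot\Big(\frac{\theta_k-\theta_j}{2}\Big)\partial_k-\frac{6-\kappa}{2\kappa}\,\frac{1}{2\sin^2\big(\frac{\theta_k-\theta_j}{2}\big)}\right).$$ (i) The function $\tilde{\mathcal Z}=\Phi_{1/\kappa}^{-1}\mathcal Z$ satisfies $\big(\Phi_{1/\kappa}^{-1}\cdot\mathcal L_j\cdot\Phi_{1/\kappa}\big)\tilde{\mathcal Z}=h\tilde{\mathcal Z}$ for each $j$, where $$\Phi_{1/\kappa}^{-1}\cdot\mathcal L_j\cdot\Phi_{1/\kappa}=\frac\kappa2\partial_j^2-F_j\partial_j+\frac1{2\kappa}F_j^2-\frac12F_j'-\sum_{k\ne j}\left(f_{jk}\Big(\partial_k-\frac1\kappa F_k\Big)-\frac{6-\kappa}{2\kappa}f_{jk}'\right).$$ The sum $\mathcal L=\sum_{j=1}^n\mathcal L_j$ satisfies $$\Phi_{-1/\kappa}\cdot\mathcal L\cdot\Phi_{1/\kappa}=\kappa H_n\Big(\frac8\kappa\Big)+\frac{n(n^2-1)}{6\kappa},$$ where $H_n(\beta)$, $\beta=8/\kappa$, is the quantum Calogero–Sutherland Hamiltonian $$H_n(\beta)=\sum_{j=1}^n\frac12\partial_j^2-\frac{\beta(\beta-2)}{16}\sum_{1\le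 j<k\le n}\frac{1}{\sin^2\big(\frac{\theta_j-\theta_k}{2}\big)} .$$ (ii) For $j\neq k$, $$[\mathcal L_j,\mathcal L_k]=\frac{1}{\sin^2\big(\frac{\theta_j-\theta_k}{2}\big)}(\mathcal L_k-\mathcal L_j),$$ and consequently $[\mathcal L_j,\mathcal L_k]\mathcal Z=\frac{1}{\sin^2(\frac{\theta_j-\theta_k}{2})}(\mathcal L_k-\mathcal L_j)\mathcal Z=0$.
   Context: $\partial_j=\partial/\partial\theta_j$. All functions are (sufficiently smooth) functions on $\mathfrak X^n=\{\boldsymbol\theta\in\mathbb R^n:\theta_1<\dots<\theta_n<\theta_1+2\pi\}$. For the purposes of this statement a partition function is a positive function $\mathcal Z$ on $\mathfrak X^n$ satisfying the displayed equations $\mathcal L_j\mathcal Z=h\mathcal Z$. Notation: $\Phi_r(\boldsymbol\theta)=\prod_{1\le j<k\le n}\big(\sin\frac{\theta_j-\theta_k}{2}\big)^{-2r}$ (a fixed branch on $\mathfrak X^n$), so $\Phi_{-1/\kappa}=\Phi_{1/\kappa}^{-1}$; $A\cdot\mathcal L\cdot B$ denotes the composition of multiplication by $B$, then $\mathcal L$, then multiplication by $A$. $f(x)=\cot(x/2)$, $f_{jk}=f(\theta_j-\theta_k)$, $F_j=\sum_{k\ne j}f_{jk}$, $f'(x)=-\frac{1}{2\sin^2(x/2)}$, $f'_{jk}=f'(\theta_j-\theta_k)$, $F'_j=\sum_{k\ne j}f'_{jk}$. *)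

(* Defs.v *)
From mathcomp Require Import all_boot all_order all_algebra.
From mathcomp Require Import all_classical all_reals all_analysis.
Import Order.TTheory GRing.Theory Num.Theory.
Import numFieldNormedType.Exports.

Set Implicit Arguments.
Unset Strict Implicit.
Unset Printing Implicit Defensive.

Local Open Scope classical_set_scope.
Local Open Scope ring_scope.

Section Domain.
Context {R : realType} {n : nat}.
Implicit Types (theta : 'rV[R]_n) (phi : 'rV[R]_n -> R).

(* theta_1 < ... < theta_n < theta_1 + 2 pi; the coordinates are numbered from
   0, and the last inequality relates the coordinates of index n.-1 and 0. *)
Definition chamber : set 'rV[R]_n := [set theta |
  (forall j k : 'I_n, (j < k)%N -> theta 0 j < theta 0 k) /\
  (forall i l : 'I_n, i = 0%N :> nat -> l = n.-1 :> nat ->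
     theta 0 l < theta 0 i + 2 * pi)].

Definition pd (j : 'I_n) phi : 'rV[R]_n -> R :=
  fun theta => 'D_(delta_mx 0 j) phi theta.

(* phi is of class C^m on U; meant for an open set U. *)
Fixpoint Cm (m : nat) (U : set 'rV[R]_n) phi : Prop :=
  (forall theta, U theta -> {for theta, continuous phi}) /\
  match m with
  | 0 => True
  | m'.+1 => forall j,
      (forall theta, U theta -> derivable phi theta (delta_mx 0 j)) /\
      Cm m' U (pd j phi)
  end.

End Domain.

Section Operators.
Context {R : realType} {n : nat}.
Notation fn := ('rV[R]_n -> R).
Implicit Types (theta : 'rV[R]_n) (phi : fn).

(* Differential operators act on functions defined on all of R^n, but only
   their values on the chamber, an open set, are ever considered. *)
Definition operator := fn -> fn.

(* A = B as operators on functions of class C^m on the chamber *)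
Definition op_eq (m : nat) (A B : operator) : Prop :=
  forall phi, Cm m chamber phi ->
  forall theta, chamber theta -> A phi theta = B phi theta.

Definition op_conj (a : fn) (L : operator) (b : fn) : operator :=
  fun phi theta => a theta * L (fun x => b x * phi x) theta.

Definition commutator (A B : operator) : operator :=
  fun phi theta => A (B phi) theta - B (A phi) theta.

Definition cot (x : R) : R := cos x / sin x.

Definition f (x : R) : R := cot (x / 2).

(* the derivative of f *)
Definition f' (x : R) : R := - (1 / (2 * sin (x / 2) ^+ 2)).

Definition fjk (j k : 'I_n) theta : R := f (theta 0 j - theta 0 k).
Definition f'jk (j k : 'I_n) theta : R := f' (theta 0 j - theta 0 k).
Definition F (j : 'I_n) theta : R := \sum_(k < n | k != j) fjk j k theta.
Definition F' (j : 'I_n) theta : R := \sum_(k < n | k != j) f'jk j k theta.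

(* On the chamber the sines with j < k are negative; the branch of
   sin ^ (- 2 r) chosen here is the positive one, |sin| ^ (- 2 r). *)
Definition Phi (r : R) : fn := fun theta =>
  \prod_(j < n) \prod_(k < n | (j < k)%N)
     `|sin ((theta 0 j - theta 0 k) / 2)| `^ (- (2 * r)).

Definition Lop (kappa : R) (j : 'I_n) : operator := fun phi theta =>
  kappa / 2 * pd j (pd j phi) theta +
  \sum_(k < n | k != j)
    (cot ((theta 0 k - theta 0 j) / 2) * pd k phi theta -
     (6 - kappa) / (2 * kappa) *
       (1 / (2 * sin ((theta 0 k - theta 0 j) / 2) ^+ 2)) * phi theta).

Definition Lsum (kappa : R) : operator := fun phi theta =>
  \sum_(j < n) Lop kappa j phi theta.

Definition Lop_conj (kappa : R) (j : 'I_n) : operator := fun phi theta =>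
  kappa / 2 * pd j (pd j phi) theta - F j theta * pd j phi theta +
  1 / (2 * kappa) * F j theta ^+ 2 * phi theta -
  1 / 2 * F' j theta * phi theta -
  \sum_(k < n | k != j)
    (fjk j k theta *
       (pd k phi theta - 1 / kappa * F k theta * phi theta) -
     (6 - kappa) / (2 * kappa) * f'jk j k theta * phi theta).

(* quantum Calogero-Sutherland Hamiltonian *)
Definition Hop (beta : R) : operator := fun phi theta =>
  (\sum_(j < n) 1 / 2 * pd j (pd j phi) theta) -
  beta * (beta - 2) / 16 *
    (\sum_(j < n) \sum_(k < n | (j < k)%N)
       1 / sin ((theta 0 j - theta 0 k) / 2) ^+ 2) * phi theta.

(* a partition function with eigenvalue h *)
Definition partition_function (kappa h : R) (Z : fn) : Prop :=
  [/\ Cm 2 chamber Z,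
      forall theta, chamber theta -> 0 < Z theta &
      forall (j : 'I_n) theta, chamber theta ->
        Lop kappa j Z theta = h * Z theta].

End Operators.

(* Main.v *)
Require Import Defs.
From mathcomp Require Import all_boot all_order all_algebra.
From mathcomp Require Import all_classical all_reals all_analysis.
From mathcomp Require Import ring lra.
Import Order.TTheory GRing.Theory Num.Theory.
Import numFieldNormedType.Exports.

Set Implicit Arguments.
Unset Strict Implicit.
Unset Printing Implicit Defensive.

Local Open Scope classical_set_scope.
Local Open Scope ring_scope.

(* On the chamber every f(theta_j - theta_k) is smooth, f'' = - f f' and
   2 f' = - (1 + f^2). With f_jj = f'_jj = 0,
     L_j = kappa/2 d_j^2 - sum_k f_jk d_k + (6 - kappa)/(2 kappa) F'_j.
   Since d_j Phi_r = - r F_j Phi_r, conjugation is the Leibniz rule, and the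
   constant in the sum of the L_j comes from
     sum_j F_j^2 = - 2 sum_j F'_j - n (n^2 - 1) / 3,
   which follows by symmetrizing the triple sum of f_jk f_jl and using
     f_jk f_kl + f_kl f_lj + f_lj f_jk = 1.
   In the commutator, the derivatives of order three and four and the mixed
   second ones cancel by the symmetry of partial derivatives. The coefficients
   of order at most one agree by the same identity, which factors 1 + f_jk^2 as
   (f_jk + f_kl) (f_jk + f_lj); kappa/2 (1 + 2 (6 - kappa)/(2 kappa)) = 3 makes
   the remaining terms in d_j and d_k match. *)

(** * Directional derivatives and the symmetry of mixed ones *)

Section DirectionalDerivatives.
Context {R : realType} {V : normedModType R}.
Implicit Types (phi : V -> R) (x u v : V).

(** The two difference quotients are the same function of the increment. This brings the chain rule
    and the mean value theorem on the real line to functions on [V]. *)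
Lemma is_derive_line phi x v (t d : R) :
  is_derive (x + t *: v) v phi d <->
  is_derive t 1 (fun s : R => phi (x + s *: v)) d.
Proof.
have E : (fun h : R => h^-1 *: ((phi \o shift (x + t *: v)) (h *: v)
                                - phi (x + t *: v))) =
         (fun h : R => h^-1 *: (((fun s : R => phi (x + s *: v)) \o shift t)
                                (h *: 1) - phi (x + t *: v))).
  by apply/funext => h /=; rewrite [h%:A]mulr1 scalerDl addrCA.
by split => -[Dphi <-]; (split; last by rewrite /derive E);
  move: Dphi; rewrite /derivable E.
Qed.

Lemma is_derive_comp (g : R -> R) phi x v (a b : R) :
  is_derive (phi x) 1 g b -> is_derive x v phi a ->
  is_derive x v (g \o phi) (b * a).
Proof.
move=> Dg Dphi.
have [to from] := is_derive_line (g \o phi) x v 0 (b * a).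
move: from; rewrite scale0r addr0; apply.
apply: (is_derive1_comp (f := g)); first by rewrite scale0r addr0.
by apply/is_derive_line; rewrite scale0r addr0.
Qed.

(** The mean value theorem is applied twice: to the difference [g] of [phi] along two parallel
    segments in direction [u], then to ['D_u phi] along a segment in direction [v]. *)
Lemma second_difference phi x u v (U : set V) (s t : R) : 0 < s -> 0 < t ->
  (forall a b, 0 <= a <= s -> 0 <= b <= t -> U (x + a *: u + b *: v)) ->
  (forall y, U y -> derivable phi y u) ->
  (forall y, U y -> derivable ('D_u phi) y v) ->
  exists a b, [/\ 0 <= a <= s, 0 <= b <= t &
    phi (x + s *: u + t *: v) - phi (x + s *: u) - (phi (x + t *: v) - phi x)
    = 'D_v ('D_u phi) (x + a *: u + b *: v) * t * s].
Proof.
move=> s0 t0 HU Du Dv.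
pose g (a : R) := phi ((x + t *: v) + a *: u) - phi (x + a *: u).
pose dg (a : R) := 'D_u phi ((x + t *: v) + a *: u) - 'D_u phi (x + a *: u).
have Dg (a : R) : 0 <= a <= s -> is_derive a 1 g (dg a).
  move=> ha; apply: is_deriveB; apply/is_derive_line; apply/derivableP;
    apply: Du.
    by rewrite addrAC; apply: HU => //; rewrite lexx ltW.
  by rewrite -[X in U X]addr0 -(scale0r v); apply: HU => //; rewrite lexx ltW.
have [||a ha Ea] := @MVT _ g dg 0 s s0.
- by move=> a; rewrite in_itv/= => /andP[? ?]; apply: Dg; rewrite !ltW.
- apply: derivable_within_continuous => a; rewrite in_itv/= => ha.
  by have [] := Dg _ ha.
have {}ha : 0 <= a <= s by move: ha; rewrite in_itv/= => /andP[? ?]; rewrite !ltW.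
pose k (b : R) := 'D_u phi ((x + a *: u) + b *: v).
pose dk (b : R) := 'D_v ('D_u phi) ((x + a *: u) + b *: v).
have Dk (b : R) : 0 <= b <= t -> is_derive b 1 k (dk b).
  move=> hb; have [to _] := is_derive_line ('D_u phi) (x + a *: u) v b (dk b).
  by apply: to; apply: DeriveDef => //; apply: Dv; exact: HU.
have [||b hb Eb] := @MVT _ k dk 0 t t0.
- by move=> b; rewrite in_itv/= => /andP[? ?]; apply: Dk; rewrite !ltW.
- apply: derivable_within_continuous => b; rewrite in_itv/= => hb.
  by have [] := Dk _ hb.
have {}hb : 0 <= b <= t by move: hb; rewrite in_itv/= => /andP[? ?]; rewrite !ltW.
exists a, b; split => //.
move: Ea Eb; rewrite /g /dg /k /dk !scale0r !addr0 !subr0 => Ea Eb.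
by rewrite -Eb [x + a *: u + _]addrAC -Ea [x + t *: v + _]addrAC.
Qed.

(** The second difference over a parallelogram with both parameters equal to [r] is symmetric in [u]
    and [v], so the two mixed derivatives agree at some pair of points near [x]. If they differed at
    [x], continuity would keep them apart there. *)
Lemma derive_swap phi x u v (U : set V) : open U -> U x ->
  (forall y, U y -> derivable phi y u) ->
  (forall y, U y -> derivable phi y v) ->
  (forall y, U y -> derivable ('D_u phi) y v) ->
  (forall y, U y -> derivable ('D_v phi) y u) ->
  {for x, continuous ('D_v ('D_u phi))} ->
  {for x, continuous ('D_u ('D_v phi))} ->
  'D_v ('D_u phi) x = 'D_u ('D_v phi) x.
Proof.
move=> oU Ux Du Dv Duv Dvu Cuv Cvu.
have HU : \forall y \near x, U y := open_nbhs_nbhs (conj oU Ux).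
apply/eqP; rewrite -subr_eq0; apply/negPn/negP => AB.
set A := 'D_v _ x in Cuv AB; set B := 'D_u _ x in Cvu AB.
have e0 : 0 < `|A - B| / 2 by rewrite divr_gt0 ?normr_gt0.
set e := _ / 2 in e0.
have HA : \forall y \near x, `|A - 'D_v ('D_u phi) y| < e.
  by move/cvgrPdist_lt: Cuv => /(_ _ e0).
have HB : \forall y \near x, `|B - 'D_u ('D_v phi) y| < e.
  by move/cvgrPdist_lt: Cvu => /(_ _ e0).
have [d /= d0 Hd] := (nbhs_normP x _).1 (filterI HA (filterI HB HU)).
(* This size keeps the whole parallelogram in the ball of radius [d]; the summand 1 makes the
   denominator positive even for [u = v = 0] and the bound strict. *)
pose r := d / (`|u| + `|v| + 1).
have m0 : 0 < `|u| + `|v| + 1 by rewrite ltr_wpDl.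
have r0 : 0 < r by rewrite divr_gt0.
have close (A' B' X Y p q s z : R) : `|A' - X| < e -> `|B' - Y| < e ->
    p - q - (s - z) = X * r * r -> p - s - (q - z) = Y * r * r ->
    `|A' - B'| < e + e.
  move=> HX HY EX EY; have XY : X = Y.
    have r_neq0 : r != 0 by rewrite gt_eqF.
    by apply: (mulIf r_neq0); apply: (mulIf r_neq0); rewrite -EX -EY; ring.
  rewrite (_ : A' - B' = (A' - X) - (B' - Y)); last by rewrite XY; ring.
  by rewrite (le_lt_trans (ler_normB _ _))// ltrD.
have Hr a b : 0 <= a <= r -> 0 <= b <= r ->
    [/\ `|A - 'D_v ('D_u phi) (x + a *: u + b *: v)| < e,
        `|B - 'D_u ('D_v phi) (x + a *: u + b *: v)| < e &
        U (x + a *: u + b *: v)].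
  move=> /andP[a0 ar] /andP[b0 br].
  suff /Hd[? []] : ball_ Num.norm x d (x + a *: u + b *: v) by split.
  rewrite /ball_/= distrC -[x + _ + _]addrA [x + (_ + _)]addrC addrK.
  rewrite (le_lt_trans (ler_normD _ _))// !normrZ !ger0_norm//.
  apply: (@le_lt_trans _ _ (r * (`|u| + `|v|))).
    by rewrite mulrDr lerD// ler_wpM2r.
  by rewrite /r mulrAC ltr_pdivrMr// ltr_pM2l// ltrDl.
have [|a [b [ha hb Eab]]] := second_difference (x := x) r0 r0 _ Du Duv.
  by move=> a b ha hb; have [] := Hr _ _ ha hb.
have [|b' [a' [hb' ha' Eba]]] := second_difference (x := x) r0 r0 _ Dv Dvu.
  by move=> b' a' hb' ha'; rewrite addrAC; have [] := Hr _ _ ha' hb'.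
have [HAab _ _] := Hr _ _ ha hb.
have [_ HBab _] := Hr _ _ ha' hb'.
rewrite [x + _ + _]addrAC in HBab.
rewrite [x + r *: v + r *: u]addrAC in Eba.
suff : `|A - B| < e + e by rewrite /e -splitr ltxx.
exact: close HAab HBab Eab Eba.
Qed.

End DirectionalDerivatives.

(** * The function cot(x/2): parity, addition formula, derivatives *)

Section HalfAngleCotangent.
Context {R : realType}.
Implicit Types x y : R.

(** Division by zero gives zero. This value and that of [f'] at 0 let sums over k != j be extended
    to all k. *)
Lemma f0 : f (0 : R) = 0.
Proof. by rewrite /f /cot mul0r sin0 invr0 mulr0. Qed.

Lemma f'0 : f' (0 : R) = 0.
Proof. by rewrite /f' mul0r sin0 expr0n/= mulr0 invr0 mulr0 oppr0. Qed.

Lemma fN x : f (- x) = - f x.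
Proof. by rewrite /f /cot mulNr cosN sinN invrN mulrN. Qed.

Lemma f'N x : f' (- x) = f' x.
Proof. by rewrite /f' mulNr sinN sqrrN. Qed.

Lemma f'E x : sin (x / 2) != 0 -> f' x = - (1 + f x ^+ 2) / 2.
Proof.
move=> sx; have := cos2Dsin2 (x / 2); rewrite /f' /f /cot.
move: (sin _) (cos _) sx => s c sx cs.
(* Writing the numerator 1 as cos^2 + sin^2 leaves a rational identity in the sine and cosine. *)
rewrite -[X in X / (2 * _)]cs; field.
by rewrite sx.
Qed.

(** This is the addition formula for the cotangent with its denominator cleared. *)
Lemma f_cyclic x y : sin (x / 2) != 0 -> sin (y / 2) != 0 ->
  sin ((x + y) / 2) != 0 ->
  f x * f y - f y * f (x + y) - f (x + y) * f x = 1.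
Proof.
rewrite /f /cot mulrDl sinD cosD.
move: (sin (x / 2)) (cos (x / 2)) (sin (y / 2)) (cos (y / 2)) => s c s' c'.
by move=> s0 s'0 ss0; field; rewrite s0 s'0 ss0.
Qed.

Lemma is_derive_half x : is_derive x (1 : R) (fun y => y / 2) 2^-1.
Proof.
rewrite (_ : (fun y => y / 2) = 2^-1 \*: id); last first.
  by apply/funext => y /=; rewrite mulrC.
rewrite -[X in is_derive _ _ _ X]mulr1.
by have := is_deriveZ 2^-1 (is_derive_id x (1 : R)).
Qed.

Lemma is_derive_sin_half x :
  is_derive x (1 : R) (fun y => sin (y / 2)) (cos (x / 2) / 2).
Proof.
by have := is_derive1_comp (g := fun y => y / 2) (is_derive_sin _) (is_derive_half x).
Qed.

Lemma is_derive_cos_half x :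
  is_derive x (1 : R) (fun y => cos (y / 2)) (- sin (x / 2) / 2).
Proof.
by have := is_derive1_comp (g := fun y => y / 2) (is_derive_cos _) (is_derive_half x).
Qed.

Lemma is_derive_f x : sin (x / 2) != 0 -> is_derive x (1 : R) f (f' x).
Proof.
move=> sx.
apply: (is_derive_eq (is_deriveM (is_derive_cos_half x)
                        (is_deriveV sx (is_derive_sin_half x)))).
rewrite /f' /GRing.scale/=.
have := cos2Dsin2 (x / 2); move: (sin _) (cos _) sx => s c sx cs.
rewrite -[X in _ = - (X / (2 * _))]cs; field.
by rewrite sx.
Qed.

Lemma is_derive_f' x : sin (x / 2) != 0 ->
  is_derive x (1 : R) f' (- (f x * f' x)).
Proof.
move=> sx; rewrite (_ : f' = fun y => - 2^-1 *: ((sin (y / 2))^-1 * (sin (y / 2))^-1)).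
  have Ds := is_deriveV sx (is_derive_sin_half x).
  apply: (is_derive_eq (is_deriveZ (- 2^-1) (is_deriveM Ds Ds))).
  rewrite /f' /f /cot /GRing.scale/=.
  by field; rewrite sx.
apply/funext => y; rewrite /f' /GRing.scale/= expr2 !invfM.
by rewrite mul1r mulNr.
Qed.

End HalfAngleCotangent.

(** * Topology of the chamber and differentiation rules on it *)

Section ChamberCalculus.
Context {R : realType} {n : nat}.
Notation fn := ('rV[R]_n -> R).
Implicit Types (theta : 'rV[R]_n) (phi psi : fn) (a b m : 'I_n).

Lemma near_forall (T : topologicalType) (I : finType) (P : I -> T -> Prop)
    (t : T) :
  (forall i, \forall x \near t, P i x) -> \forall x \near t, forall i, P i x.
Proof. exact: filter_forall. Qed.

Lemma near_imply (T : topologicalType) (A : Prop) (P : T -> Prop) (t : T) :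
  (A -> \forall x \near t, P x) -> \forall x \near t, A -> P x.
Proof.
have [a /(_ a)|na _] := pselect A; first by apply: filterS => x Px _.
by apply: nearW => x /na.
Qed.

(** The chamber is cut out by finitely many strict inequalities between continuous functions.
    Openness makes derivatives at its points depend only on values inside it. *)
Lemma open_chamber : open (@chamber R n).
Proof.
have pos_near (g : fn) theta : continuous g -> 0 < g theta ->
    \forall x \near theta, 0 < g x by move=> cg; exact: cvgr_gt (cg theta) _.
have cont i j (c : R) : continuous (fun x : 'rV[R]_n => x 0 i - x 0 j + c).
  move=> x.
  have ck k : {for x, continuous (fun y : 'rV[R]_n => y 0 k)}.
    exact: coord_continuous.
  have cc : {for x, continuous (cst c : fn)} by exact: cst_continuous.
  have cij : {for x, continuous
      ((fun y : 'rV[R]_n => y 0 i) - (fun y => y 0 j))}.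
    exact: continuousB (ck i) (ck j).
  exact: continuousD cij cc.
rewrite openE => theta [lt_jk lt_2pi].
have near1 : \forall x \near theta, forall j k : 'I_n,
    (j < k)%N -> (x : 'rV[R]_n) 0 j < x 0 k.
  apply: (near_forall (P := fun (j : 'I_n) (x : 'rV[R]_n) =>
    forall k : 'I_n, (j < k)%N -> x 0 j < x 0 k)) => j.
  apply: (near_forall (P := fun (k : 'I_n) (x : 'rV[R]_n) =>
    (j < k)%N -> x 0 j < x 0 k)) => k.
  apply: (near_imply (P := fun x : 'rV[R]_n => x 0 j < x 0 k)) => jk.
  have := pos_near _ theta (cont k j 0).
  rewrite addr0 subr_gt0 => /(_ (lt_jk _ _ jk)); apply: filterS => x.
  by rewrite addr0 subr_gt0.
have near2 : \forall x \near theta, forall i l : 'I_n,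
    i = 0%N :> nat -> l = n.-1 :> nat ->
    (x : 'rV[R]_n) 0 l < x 0 i + 2 * pi.
  apply: (near_forall (P := fun (i : 'I_n) (x : 'rV[R]_n) =>
    forall l : 'I_n, i = 0%N :> nat -> l = n.-1 :> nat ->
    x 0 l < x 0 i + 2 * pi)) => i.
  apply: (near_forall (P := fun (l : 'I_n) (x : 'rV[R]_n) =>
    i = 0%N :> nat -> l = n.-1 :> nat -> x 0 l < x 0 i + 2 * pi)) => l.
  apply: (near_imply (P := fun x : 'rV[R]_n => l = n.-1 :> nat ->
    x 0 l < x 0 i + 2 * pi)) => i0.
  apply: (near_imply (P := fun x : 'rV[R]_n => x 0 l < x 0 i + 2 * pi)) => ln.
  have := pos_near _ theta (cont i l (2 * pi)).
  rewrite addrAC subr_gt0 => /(_ (lt_2pi _ _ i0 ln)); apply: filterS => x.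
  by rewrite addrAC subr_gt0.
exact: filterI near1 near2.
Qed.

Lemma chamber_near theta : chamber theta -> \forall x \near theta, chamber x.
Proof. by move=> ht; exact: open_nbhs_nbhs (conj open_chamber ht). Qed.

(** Both coordinates lie between the first and the last one, which are less than 2 pi apart, so half
    the difference lies strictly between - pi and 0. *)
Lemma sin_chamber_lt0 theta a b : chamber theta -> (a < b)%N ->
  sin ((theta 0 a - theta 0 b) / 2) < 0.
Proof.
move=> [lt_jk lt_2pi] ab; rewrite -opprB mulNr sinN oppr_lt0.
have n0 : (0 < n)%N by apply: leq_trans (ltn_ord a).
have n1 : (n.-1 < n)%N by rewrite prednK.
have lo : theta 0 (Ordinal n0) <= theta 0 a.
  have [->|/eqP a0] := eqVneq a (Ordinal n0); first exact: lexx.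
  apply/ltW/lt_jk => /=; rewrite lt0n; apply/eqP => e; apply: a0; exact: val_inj.
have hi : theta 0 b <= theta 0 (Ordinal n1).
  have [->|/eqP bn] := eqVneq b (Ordinal n1); first exact: lexx.
  apply/ltW/lt_jk => /=; rewrite ltn_neqAle -ltnS prednK// ltn_ord andbT.
  apply/eqP => e; apply: bn; exact: val_inj.
have := lt_2pi (Ordinal n0) (Ordinal n1) erefl erefl.
have := lt_jk _ _ ab => H1 H2.
by apply: sin_gt0_pi; apply/andP; split; lra.
Qed.

Lemma sin_chamber_neq0 theta a b : chamber theta -> a != b ->
  sin ((theta 0 a - theta 0 b) / 2) != 0.
Proof.
move=> ht; rewrite -val_eqE neq_ltn => /orP[ab|ba].
  by rewrite lt_eqF// sin_chamber_lt0.
by rewrite -opprB mulNr sinN oppr_eq0 lt_eqF// sin_chamber_lt0.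
Qed.

Lemma fjk_diag a theta : fjk a a theta = 0.
Proof. by rewrite /fjk subrr f0. Qed.

Lemma f'jk_diag a theta : f'jk a a theta = 0.
Proof. by rewrite /f'jk subrr f'0. Qed.

Lemma fjkC a b theta : fjk a b theta = - fjk b a theta.
Proof. by rewrite /fjk -opprB fN. Qed.

Lemma f'jkC a b theta : f'jk a b theta = f'jk b a theta.
Proof. by rewrite /f'jk -opprB f'N. Qed.

Lemma FE a theta : F a theta = \sum_b fjk a b theta.
Proof. by rewrite /F [RHS](bigD1 a)//= fjk_diag add0r. Qed.

Lemma F'E a theta : F' a theta = \sum_b f'jk a b theta.
Proof. by rewrite /F' [RHS](bigD1 a)//= f'jk_diag add0r. Qed.

Lemma f'jkE a b theta : chamber theta -> a != b ->
  f'jk a b theta = - (1 + fjk a b theta ^+ 2) / 2.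
Proof. by move=> ht ab; rewrite /f'jk f'E// sin_chamber_neq0. Qed.

Lemma fjk_cyclic a b c theta : chamber theta -> a != b -> b != c -> a != c ->
  fjk a b theta * fjk b c theta + fjk b c theta * fjk c a theta
  + fjk c a theta * fjk a b theta = 1.
Proof.
move=> ht ab bc ac; rewrite (fjkC c a) mulrN mulNr /fjk.
rewrite -(@f_cyclic _ (theta 0 a - theta 0 b) (theta 0 b - theta 0 c)).
- by rewrite addrA subrK.
- exact: sin_chamber_neq0.
- exact: sin_chamber_neq0.
- by rewrite addrA subrK; exact: sin_chamber_neq0.
Qed.

(** Existence and value of the partial derivative are carried together, so that the derivative of a
    compound expression is obtained by composing rules. *)
Definition D (m : 'I_n) phi psi : Prop := forall theta, chamber theta ->
  is_derive theta (delta_mx 0 m : 'rV[R]_n) phi (psi theta).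

Lemma D_pd m phi psi theta : D m phi psi -> chamber theta ->
  pd m phi theta = psi theta.
Proof. by move=> Dphi ht; have [_] := Dphi _ ht. Qed.

Lemma pd_chamber m phi psi theta :
  (forall x, chamber x -> phi x = psi x) -> chamber theta ->
  pd m phi theta = pd m psi theta.
Proof.
move=> E ht; apply: near_eq_derive; apply: filterS (chamber_near ht).
by move=> x /E.
Qed.

Lemma D_chamber m phi phi' psi psi' :
  (forall x, chamber x -> phi x = phi' x) ->
  (forall x, chamber x -> psi x = psi' x) ->
  D m phi psi -> D m phi' psi'.
Proof.
move=> E E' Dphi theta ht; rewrite -E'//.
apply: near_eq_is_derive (Dphi _ ht); apply: filterS (chamber_near ht).
by move=> x /E.
Qed.

Lemma D_eq m phi psi psi' : D m phi psi ->
  (forall x, chamber x -> psi x = psi' x) -> D m phi psi'.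
Proof. by move=> Dphi E; apply: D_chamber Dphi. Qed.

Lemma D_cst m (c : R) : D m (fun=> c) (fun=> 0).
Proof. by move=> theta _; exact: is_derive_cst. Qed.

Lemma D_add m phi psi dphi dpsi : D m phi dphi -> D m psi dpsi ->
  D m (fun x => phi x + psi x) (fun x => dphi x + dpsi x).
Proof. by move=> H K theta ht; exact: is_deriveD (H _ ht) (K _ ht). Qed.

Lemma D_sub m phi psi dphi dpsi : D m phi dphi -> D m psi dpsi ->
  D m (fun x => phi x - psi x) (fun x => dphi x - dpsi x).
Proof. by move=> H K theta ht; exact: is_deriveB (H _ ht) (K _ ht). Qed.

Lemma D_mul m phi psi dphi dpsi : D m phi dphi -> D m psi dpsi ->
  D m (fun x => phi x * psi x) (fun x => dphi x * psi x + phi x * dpsi x).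
Proof.
move=> H K theta ht; apply: (is_derive_eq (is_deriveM (H _ ht) (K _ ht))).
by rewrite /GRing.scale/= addrC [psi _ * _]mulrC.
Qed.

Lemma D_scale m (c : R) phi dphi : D m phi dphi ->
  D m (fun x => c * phi x) (fun x => c * dphi x).
Proof.
move=> H; apply: D_eq (D_mul (@D_cst m c) H) _ => x _ /=.
by rewrite mul0r add0r.
Qed.

Lemma D_sum m (I : finType) (P : pred I) (phi dphi : I -> fn) :
  (forall i, D m (phi i) (dphi i)) ->
  D m (fun x => \sum_(i | P i) phi i x) (fun x => \sum_(i | P i) dphi i x).
Proof.
move=> H theta ht.
rewrite (_ : (fun x => _) = \sum_(i | P i) phi i); last first.
  by apply/funext => x; rewrite fct_sumE.
elim/big_rec2: _ => [|i g d _ IH]; first exact: is_derive_cst.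
exact: is_deriveD (H _ _ ht) IH.
Qed.

Lemma is_derive_coord_diff a b m theta :
  is_derive theta (delta_mx 0 m : 'rV[R]_n) (fun x => x 0 a - x 0 b)
    ((a == m)%:R - (b == m)%:R).
Proof.
rewrite -[theta]addr0 -(scale0r (delta_mx 0 m)); apply/is_derive_line.
rewrite (_ : (fun s : R => _) = (fun s : R => (theta 0 a - theta 0 b)
   + ((a == m)%:R - (b == m)%:R) *: s)); last first.
  apply/funext => s; rewrite !mxE /=/GRing.scale/=; ring.
apply: (is_derive_eq (is_deriveD (is_derive_cst _ _ _) (is_deriveZ _ (is_derive_id _ _)))).
by rewrite add0r /GRing.scale/= mulr1.
Qed.

(** The Kronecker symbols give one formula for all indices: for [a = b] the function is identically
    0 and the two symbols cancel. *)
Lemma D_fjk m a b : D m (fjk a b)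
  (fun x => f'jk a b x * ((a == m)%:R - (b == m)%:R)).
Proof.
move=> theta ht; have [<-|ab] := eqVneq a b.
  rewrite subrr mulr0 (_ : fjk a a = cst 0); first exact: is_derive_cst.
  by apply/funext => x; rewrite fjk_diag.
apply: (is_derive_comp (g := f)); last exact: is_derive_coord_diff.
by apply: is_derive_f; exact: sin_chamber_neq0.
Qed.

Lemma D_f'jk m a b : D m (f'jk a b)
  (fun x => - (fjk a b x * f'jk a b x) * ((a == m)%:R - (b == m)%:R)).
Proof.
move=> theta ht; have [<-|ab] := eqVneq a b.
  rewrite subrr mulr0 (_ : f'jk a a = cst 0); first exact: is_derive_cst.
  by apply/funext => x; rewrite f'jk_diag.
apply: (is_derive_comp (g := f')); last exact: is_derive_coord_diff.
by apply: is_derive_f'; exact: sin_chamber_neq0.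
Qed.

Lemma Cm_pd k phi m : Cm k.+1 chamber phi -> Cm k chamber (pd m phi).
Proof. by case=> _ /(_ m)[]. Qed.

Lemma Cm_le k l phi : (k <= l)%N -> Cm l chamber phi -> Cm k chamber phi.
Proof.
elim: l k phi => [[]//|l IH [|k] phi kl]; first by case.
by case=> C H; split=> // j; have [? ?] := H j; split=> //; exact: IH.
Qed.

Lemma Cm_D k phi m : Cm k.+1 chamber phi -> D m phi (pd m phi).
Proof.
case=> _ /(_ m)[H _] theta ht; apply: DeriveDef => //; exact: H.
Qed.

Lemma pdC phi a b theta : Cm 2 chamber phi -> chamber theta ->
  pd a (pd b phi) theta = pd b (pd a phi) theta.
Proof.
move=> C ht.
apply: (derive_swap open_chamber ht).
- by move=> y hy; have [+ _] := Cm_D b C hy.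
- by move=> y hy; have [+ _] := Cm_D a C hy.
- by move=> y hy; have [+ _] := Cm_D a (Cm_pd b C) hy.
- by move=> y hy; have [+ _] := Cm_D b (Cm_pd a C) hy.
- by have [+ _] := Cm_pd a (Cm_pd b C); exact.
- by have [+ _] := Cm_pd b (Cm_pd a C); exact.
Qed.

End ChamberCalculus.

(** * Kronecker sums and symmetric double sums *)

Section FiniteSums.
Context {R : comNzRingType} {n : nat}.

Lemma sum_delta (g : 'I_n -> R) m : \sum_j g j * (j == m)%:R = g m.
Proof.
rewrite (bigD1 m)//= eqxx mulr1 big1 ?addr0// => j /negbTE ->.
by rewrite mulr0.
Qed.

Lemma sum_delta1 m : \sum_(j < n) (j == m)%:R = 1 :> R.
Proof. by rewrite -[RHS](sum_delta (fun=> 1) m); apply: eq_bigr => j; rewrite mul1r. Qed.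

Lemma sum_ltn_sym (g : 'I_n -> 'I_n -> R) :
  (forall j k, g j k = g k j) -> (forall j, g j j = 0) ->
  \sum_j \sum_k g j k = 2 * \sum_(j < n) \sum_(k < n | (j < k)%N) g j k.
Proof.
move=> gC g0.
have -> : \sum_j \sum_k g j k = \sum_(j < n) \sum_(k < n | (j < k)%N) g j k +
    \sum_(j < n) \sum_(k < n | (k < j)%N) g j k.
  rewrite -big_split; apply: eq_bigr => j _ /=.
  rewrite (bigID (fun k : 'I_n => (j < k)%N))/=; congr (_ + _).
  rewrite (bigD1 j) ?ltnn//= g0 add0r; apply: eq_bigl => k.
  by rewrite -leqNgt -val_eqE/= [RHS]ltn_neqAle andbC.
rewrite [X in _ + X](_ : _ = \sum_(j < n) \sum_(k < n | (j < k)%N) g j k).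
  by rewrite mulr_natl mulr2n.
rewrite (exchange_big_dep predT)//=; apply: eq_bigr => j _.
by apply: eq_bigr => k _; exact: gC.
Qed.

End FiniteSums.

(** * The prefactor [Phi r] and its logarithmic derivative *)

Section Prefactor.
Context {R : realType} {n : nat}.
Notation fn := ('rV[R]_n -> R).
Implicit Types (theta : 'rV[R]_n) (phi : fn) (m : 'I_n).

(** Logarithmic derivatives add up over a product; writing each derivative as [l i x * phi i x]
    avoids dividing by the factors. *)
Lemma D_prod m (I : finType) (P : pred I) (phi l : I -> fn) :
  (forall i, P i -> D m (phi i) (fun x => l i x * phi i x)) ->
  D m (fun x => \prod_(i | P i) phi i x)
      (fun x => (\sum_(i | P i) l i x) * \prod_(i | P i) phi i x).
Proof.
move=> Dphi; elim: (index_enum I) => [|i s IH].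
  apply: D_chamber (@D_cst _ _ m 1) => x _; first by rewrite big_nil.
  by rewrite !big_nil mul0r.
have [Pi|/negbTE Pi] := boolP (P i); last first.
  by apply: D_chamber IH => x _; rewrite !big_cons Pi.
apply: D_chamber (D_mul (Dphi i Pi) IH) => x _; rewrite !big_cons Pi//.
ring.
Qed.

(** The factor of the pair j < k has logarithmic derivative [l j k], and only the pairs that contain
    [m] contribute. *)
Lemma D_Phi (r : R) m : D m (Phi r) (fun x => - (r * F m x) * Phi r x).
Proof.
pose l (j k : 'I_n) x : R := - r * (fjk j k x * ((j == m)%:R - (k == m)%:R)).
suff DPhi : D m (Phi r) (fun x =>
    (\sum_(j < n) \sum_(k < n | (j < k)%N) l j k x) * Phi r x).
  apply: D_eq DPhi _ => x _; congr (_ * _).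
  under eq_bigr do rewrite -mulr_sumr.
  rewrite -mulr_sumr mulNr; congr (- (_ * _)).
  (* The summand is symmetric in j and k, so twice the sum over pairs is the full double sum. Its
     two Kronecker terms give [F m] each, the second one by antisymmetry of [fjk]. *)
  apply: (@mulfI _ 2) => //; rewrite -sum_ltn_sym; first last.
  - by move=> j; rewrite subrr mulr0.
  - by move=> j k; rewrite fjkC; ring.
  under eq_bigr do under eq_bigr do rewrite mulrBr.
  under eq_bigr do rewrite sumrB sum_delta -mulr_suml.
  rewrite sumrB sum_delta FE -(opprK (\sum_j fjk j m x)) -sumrN.
  by under [X in _ - - X]eq_bigr do rewrite -fjkC; rewrite opprK; ring.
apply: D_prod => j _; apply: D_prod => k jk theta ht.
(* For j < k the sine is negative on the chamber, so the absolute value is locally a smooth positive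
   function and the rule for real powers applies. *)
have Es (x : 'rV[R]_n) : chamber x -> - sin ((x 0 j - x 0 k) / 2) =
    `|sin ((x 0 j - x 0 k) / 2)|.
  by move=> hx; rewrite ltr0_norm// sin_chamber_lt0.
apply: (near_eq_is_derive
    (f := (fun y : R => (- sin (y / 2)) `^ (- (2 * r))) \o
          (fun x : 'rV[R]_n => x 0 j - x 0 k))).
  by apply: filterS (chamber_near ht) => x hx /=; rewrite Es.
have s0 : 0 < - sin ((theta 0 j - theta 0 k) / 2).
  by rewrite oppr_gt0 sin_chamber_lt0.
set y0 := theta 0 j - theta 0 k in s0 *.
have Dg : is_derive y0 (1 : R) (fun y => (- sin (y / 2)) `^ (- (2 * r)))
    (- (2 * r) * (- sin (y0 / 2)) `^ (- (2 * r) - 1) * - (cos (y0 / 2) / 2)).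
  exact: (is_derive1_comp (g := fun y => - sin (y / 2))
    (is_derive1_powR (- (2 * r)) s0) (is_deriveN (is_derive_sin_half y0))).
apply: is_derive_eq.
  exact: (is_derive_comp (phi := fun x : 'rV[R]_n => x 0 j - x 0 k) Dg
    (is_derive_coord_diff j k m theta)).
have -> : (- sin (y0 / 2)) `^ (- (2 * r) - 1) =
    (- sin (y0 / 2)) `^ (- (2 * r)) / - sin (y0 / 2).
  by rewrite powRB ?powRr1 ?(ltW s0)//; apply/implyP => _; rewrite gt_eqF.
rewrite /l -Es//.
rewrite /fjk /f /cot -/y0; field.
by rewrite -oppr_eq0 gt_eqF.
Qed.

Lemma Phi_gt0 (r : R) theta : chamber theta -> 0 < Phi r theta.
Proof.
move=> ht; apply: prodr_gt0 => j _; apply: prodr_gt0 => k jk.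
by rewrite powR_gt0// normr_gt0 lt_eqF// sin_chamber_lt0.
Qed.

Lemma PhiN (r : R) theta : Phi (- r) theta = (Phi r theta)^-1.
Proof.
rewrite /Phi -prodfV; apply: eq_bigr => j _.
by rewrite -prodfV; apply: eq_bigr => k _; rewrite -powRN mulrN.
Qed.

Lemma D_F m : D m (F m : fn) (F' m).
Proof.
have H := D_sum predT (fun b => @D_fjk R n m m b).
apply: D_chamber H => x _; first by rewrite FE.
rewrite F'E; apply: eq_bigr => b _; rewrite eqxx.
by have [->|_] := eqVneq b m; rewrite ?f'jk_diag ?mul0r// subr0 mulr1.
Qed.

End Prefactor.

(** * Conjugation by [Phi (1 / kappa)] and the Calogero-Sutherland Hamiltonian *)

Section Conjugation.
Context {R : realType} {n : nat}.
Notation fn := ('rV[R]_n -> R).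
Implicit Types (theta : 'rV[R]_n) (phi : fn) (kappa : R) (j k : 'I_n).

Lemma inv_sin2E j k theta :
  1 / sin ((theta 0 j - theta 0 k) / 2) ^+ 2 = - 2 * f'jk j k theta.
Proof.
rewrite /f'jk /f' !mul1r mulrNN [in RHS]invfM mulVKf// pnatr_eq0.
Qed.

(** All later computations use this form: [f] is odd, [f'] is even, and the vanishing diagonal terms
    allow unrestricted sums. *)
Lemma LopE kappa j phi theta : Lop kappa j phi theta =
  kappa / 2 * pd j (pd j phi) theta - \sum_k fjk j k theta * pd k phi theta +
  (6 - kappa) / (2 * kappa) * F' j theta * phi theta.
Proof.
rewrite /Lop -[RHS]addrA; congr (_ + _).
rewrite F'E -[_ * _ * phi theta]mulrAC mulr_sumr -sumrN -big_split/=.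
rewrite [RHS](bigD1 j)//= fjk_diag f'jk_diag mul0r mulr0 oppr0 !add0r.
apply: eq_bigr => k _.
rewrite fjkC f'jkC mulNr opprK /fjk /f'jk /f /f'; ring.
Qed.

Lemma Lop_conjE kappa j phi theta : Lop_conj kappa j phi theta =
  kappa / 2 * pd j (pd j phi) theta - F j theta * pd j phi theta +
  1 / (2 * kappa) * F j theta ^+ 2 * phi theta -
  1 / 2 * F' j theta * phi theta -
  \sum_k fjk j k theta * (pd k phi theta - 1 / kappa * F k theta * phi theta)
  + (6 - kappa) / (2 * kappa) * F' j theta * phi theta.
Proof.
rewrite /Lop_conj -[RHS]addrA; congr (_ + _).
rewrite F'E -[_ * _ * phi theta]mulrAC mulr_sumr -sumrN -sumrN -big_split/=.
rewrite [RHS](bigD1 j)//= fjk_diag f'jk_diag mul0r mulr0 oppr0 !add0r.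
by apply: eq_bigr => k _; ring.
Qed.

Lemma pd_Phi_mul (r : R) j phi theta : Cm 1 chamber phi -> chamber theta ->
  pd j (fun x => Phi r x * phi x) theta =
  Phi r theta * (pd j phi theta - r * F j theta * phi theta).
Proof.
move=> C ht; rewrite (D_pd (D_mul (D_Phi r j) (Cm_D j C)) ht); ring.
Qed.

Lemma pd2_Phi_mul (r : R) j phi theta : Cm 2 chamber phi -> chamber theta ->
  pd j (pd j (fun x => Phi r x * phi x)) theta =
  Phi r theta * (pd j (pd j phi) theta - 2 * r * F j theta * pd j phi theta
    + (r ^+ 2 * F j theta ^+ 2 - r * F' j theta) * phi theta).
Proof.
move=> C ht; have C1 := Cm_le (leqnSn 1) C.
(* The first derivative is again [Phi r] times a function, so the product rule is applied once more
   to that shape. *)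
have Dj := D_mul (D_Phi r j) (D_sub (Cm_D j (Cm_pd j C))
  (D_mul (D_scale r (@D_F _ _ j)) (Cm_D j C1))).
rewrite (pd_chamber j (psi := fun x => Phi r x *
  (pd j phi x - r * F j x * phi x)) _ ht); last first.
  by move=> x hx; exact: pd_Phi_mul.
rewrite (D_pd Dj ht); ring.
Qed.

(** With r = 1/kappa, the factor kappa/2 turns the terms of [pd2_Phi_mul] into - F_j d_j + F_j^2/(2
    kappa) - F'_j/2. *)
Lemma op_conj_Lop kappa j phi theta : kappa != 0 -> Cm 2 chamber phi ->
  chamber theta ->
  op_conj (fun x => (Phi (1 / kappa) x)^-1) (Lop kappa j) (Phi (1 / kappa))
    phi theta = Lop_conj kappa j phi theta.
Proof.
move=> k0 C ht; have C1 := Cm_le (leqnSn 1) C.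
rewrite /op_conj LopE Lop_conjE pd2_Phi_mul//.
under eq_bigr do rewrite pd_Phi_mul// mulrCA.
rewrite -mulr_sumr.
have P0 : Phi (1 / kappa) theta != 0 by rewrite gt_eqF// Phi_gt0.
move: (Phi _ theta) P0 => P P0.
move: (\sum_k _) => S; move: (pd _ _ _) (pd _ _ _) => p2 p1.
by field; rewrite P0 k0.
Qed.

(** By antisymmetry the column sums of [fjk] are the negatives of its row sums [F]. *)
Lemma sum_fjk_mul (g : 'I_n -> R) theta :
  \sum_j \sum_k fjk j k theta * g k = - \sum_k F k theta * g k.
Proof.
rewrite exchange_big -sumrN; apply: eq_bigr => k _ /=.
rewrite -mulr_suml -mulNr FE -sumrN; congr (_ * _).
by apply: eq_bigr => j _; rewrite fjkC.
Qed.

Lemma sum_inv_sin2 theta :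
  \sum_(j < n) \sum_(k < n | (j < k)%N)
    1 / sin ((theta 0 j - theta 0 k) / 2) ^+ 2 = - \sum_j F' j theta.
Proof.
under eq_bigr do under eq_bigr do rewrite inv_sin2E.
apply: (@mulfI _ 2) => //; rewrite -sum_ltn_sym; first last.
- by move=> j; rewrite f'jk_diag mulr0.
- by move=> j k; rewrite f'jkC.
rewrite mulrN -mulNr mulr_sumr; apply: eq_bigr => j _.
by rewrite F'E mulr_sumr.
Qed.

(* The cyclic sum over the three vertices of a triangle is -1 when they are
   distinct; the other terms correct for coincidences. *)
Lemma fjk_triple j k l theta : chamber theta ->
  fjk j k theta * fjk j l theta + fjk k j theta * fjk k l theta +
    fjk l j theta * fjk l k theta =
  -1 + - 2 * (k == j)%:R * f'jk j l theta + - 2 * f'jk j k theta * (l == k)%:R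
    + - 2 * f'jk j k theta * (l == j)%:R + (k == j)%:R * (l == k)%:R.
Proof.
move=> ht; have [->|kj] := eqVneq k j.
  have [->|lj] := eqVneq l j; first by rewrite fjk_diag f'jk_diag /=; ring.
  rewrite fjk_diag (fjkC l j) f'jk_diag (f'jkE ht (_ : j != l)) 1?eq_sym//.
  by rewrite /=; field.
have [->|lk] := eqVneq l k.
  rewrite fjk_diag (negbTE kj) (fjkC k j) (f'jkE ht (_ : j != k)) 1?eq_sym//.
  by rewrite /=; field.
have [->|lj] := eqVneq l j.
  rewrite fjk_diag (fjkC k j) (f'jkE ht (_ : j != k)) 1?eq_sym//.
  by rewrite /=; field.
rewrite (fjkC j l) (fjkC k j) (fjkC l k).
have jk : j != k by rewrite eq_sym.
have kl : k != l by rewrite eq_sym.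
have jl : j != l by rewrite eq_sym.
by have := fjk_cyclic ht jk kl jl; rewrite /=; lra.
Qed.

(** Renaming indices writes the sum [T] in three ways; added up, they have the cyclic summand
    evaluated by [fjk_triple]. The sums over l, k and j are then carried out in turn. *)
Lemma sum_sqr_F theta : chamber theta ->
  \sum_j F j theta ^+ 2 =
  - 2 * \sum_j F' j theta - n%:R * (n%:R ^+ 2 - 1) / 3.
Proof.
move=> ht; set T := LHS.
pose g j k l := fjk j k theta * fjk j l theta.
have T1 : T = \sum_j \sum_k \sum_l g j k l.
  by apply: eq_bigr => j _; rewrite expr2 FE big_distrlr.
have T2 : T = \sum_j \sum_k \sum_l g k j l by rewrite T1 exchange_big.
have T3 : T = \sum_j \sum_k \sum_l g l j k.
  rewrite T1 exchange_big /=; apply: eq_bigr => j _.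
  by rewrite exchange_big.
have {T1 T2 T3} : T + T + T = \sum_j \sum_k \sum_l (g j k l + g k j l + g l j k).
  rewrite {1}T1 {1}T2 T3 -!big_split; apply: eq_bigr => j _ /=.
  rewrite -!big_split; apply: eq_bigr => k _ /=.
  by rewrite -!big_split.
have inner j k : \sum_l (g j k l + g k j l + g l j k) =
    - n%:R + (1 - 2 * F' j theta) * (k == j)%:R - 4 * f'jk j k theta.
  under eq_bigr do rewrite fjk_triple//.
  rewrite !big_split/= sumr_const card_ord -!mulr_sumr -F'E !sum_delta1.
  by rewrite mulNrn; ring.
have mid j : \sum_k (- n%:R + (1 - 2 * F' j theta) * (k == j)%:R
    - 4 * f'jk j k theta) = 1 - n%:R ^+ 2 - 6 * F' j theta.
  rewrite sumrB big_split/= sumr_const card_ord -!mulr_sumr -F'E sum_delta1.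
  by rewrite mulNrn -mulr_natr; ring.
under eq_bigr do under eq_bigr do rewrite inner.
under eq_bigr do rewrite mid.
rewrite sumrB sumr_const card_ord -mulr_sumr -[(1 - _) *+ n]mulr_natr => H.
apply: (@mulfI _ 3) => //; transitivity (T + T + T); first by ring.
by rewrite H; field.
Qed.

(** By [sum_fjk_mul] the first-order terms cancel and the squares [F j ^+ 2] keep the coefficient
    1/(2 kappa) - 1/kappa. Through [sum_sqr_F] they yield the constant, and the total coefficient of
    the sum of the [F' j] becomes 4/kappa - 1 = kappa beta (beta - 2)/16 for beta = 8/kappa. *)
Lemma Lsum_conj kappa phi theta : kappa != 0 -> chamber theta ->
  \sum_j Lop_conj kappa j phi theta = kappa * Hop (8 / kappa) phi theta +
    n%:R * (n%:R ^+ 2 - 1) / (6 * kappa) * phi theta.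
Proof.
move=> k0 ht.
have E j : Lop_conj kappa j phi theta =
    kappa / 2 * pd j (pd j phi) theta - F j theta * pd j phi theta
    + phi theta / (2 * kappa) * F j theta ^+ 2
    + ((6 - kappa) / (2 * kappa) - 1 / 2) * phi theta * F' j theta
    - \sum_k fjk j k theta * pd k phi theta
    + phi theta / kappa * \sum_k fjk j k theta * F k theta.
  rewrite Lop_conjE [phi theta / kappa * _]mulr_sumr.
  under [X in _ - X + _]eq_bigr do rewrite mulrBr.
  rewrite sumrB.
  rewrite (_ : \sum_k fjk j k theta * (1 / kappa * F k theta * phi theta) =
    \sum_k phi theta / kappa * (fjk j k theta * F k theta)); first by ring.
  by apply: eq_bigr => k _; ring.
under eq_bigr do rewrite E.
rewrite !big_split/= !sumrN -!mulr_sumr !sum_fjk_mul.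
rewrite [\sum_k F k theta * F k theta](_ : _ = \sum_k F k theta ^+ 2) //.
rewrite sum_sqr_F// /Hop sum_inv_sin2 -mulr_sumr.
by field.
Qed.

End Conjugation.

(** * The commutation relation of the operators [Lop] *)

Section Commutator.
Context {R : realType} {n : nat}.
Notation fn := ('rV[R]_n -> R).
Implicit Types (theta : 'rV[R]_n) (phi : fn) (kappa : R) (j k l m : 'I_n).

Lemma pd_pd2C phi j l theta : Cm 3 chamber phi -> chamber theta ->
  pd j (pd j (pd l phi)) theta = pd l (pd j (pd j phi)) theta.
Proof.
move=> C ht; rewrite -(pdC j l (Cm_pd j C) ht); apply: pd_chamber ht => x hx.
exact: pdC (Cm_le (leqnSn 2) C) hx.
Qed.

Lemma pd2_pd2C phi j k theta : Cm 4 chamber phi -> chamber theta ->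
  pd j (pd j (pd k (pd k phi))) theta = pd k (pd k (pd j (pd j phi))) theta.
Proof.
move=> C ht; rewrite (pd_pd2C _ _ (Cm_pd k C) ht); apply: pd_chamber ht => x hx.
exact: pd_pd2C (Cm_le (leqnSn 3) C) hx.
Qed.

Lemma D_F' m k : D m (F' k : fn) (fun x => \sum_l
  - (fjk k l x * f'jk k l x) * ((k == m)%:R - (l == m)%:R)).
Proof.
have H := D_sum predT (fun l => @D_f'jk R n m k l).
by apply: D_chamber H => x _; first by rewrite F'E.
Qed.

Lemma D_F'_neq j k : j != k ->
  D j (F' k : fn) (fun x => fjk k j x * f'jk k j x).
Proof.
rewrite eq_sym => /negbTE kj; apply: D_eq (@D_F' j k) _ => x _.
rewrite -[RHS](sum_delta (fun l => fjk k l x * f'jk k l x)).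
by apply: eq_bigr => l _; rewrite kj /=; ring.
Qed.

Lemma D_Lop kappa m k phi : Cm 3 chamber phi ->
  D m (Lop kappa k phi) (fun x =>
    kappa / 2 * pd m (pd k (pd k phi)) x
    - \sum_l (f'jk k l x * ((k == m)%:R - (l == m)%:R) * pd l phi x
              + fjk k l x * pd m (pd l phi) x)
    + (6 - kappa) / (2 * kappa) *
      ((\sum_l - (fjk k l x * f'jk k l x) * ((k == m)%:R - (l == m)%:R))
         * phi x + F' k x * pd m phi x)).
Proof.
move=> C.
have H := D_add (D_sub (D_scale (kappa / 2) (Cm_D m (Cm_pd k (Cm_pd k C))))
    (D_sum predT (fun l => D_mul (D_fjk m k l) (Cm_D m (Cm_pd l C)))))
  (D_mul (D_scale ((6 - kappa) / (2 * kappa)) (@D_F' m k))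
     (Cm_D m (Cm_le (leq_trans (leqnSn 1) (leqnSn 2)) C))).
apply: D_chamber H => x _; first by rewrite LopE.
by rewrite mulrDr !mulrA.
Qed.

(** As [k != j], only the terms with l = j have coefficients depending on the coordinate j, so the
    Kronecker sums of [D_Lop] collapse. *)
Lemma D_Lop_neq kappa j k phi : j != k -> Cm 3 chamber phi ->
  D j (Lop kappa k phi) (fun x =>
    kappa / 2 * pd j (pd k (pd k phi)) x + f'jk k j x * pd j phi x
    - \sum_l fjk k l x * pd j (pd l phi) x
    + (6 - kappa) / (2 * kappa) *
      (fjk k j x * f'jk k j x * phi x + F' k x * pd j phi x)).
Proof.
move=> jk C; have kj : (k == j) = false by rewrite eq_sym (negbTE jk).
apply: D_eq (D_Lop kappa j k C) _ => x hx.
(* The Kronecker sum is folded back into the derivative of [F' k], whose value is then taken from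
   the collapsed formula. *)
rewrite -(D_pd (@D_F' j k) hx) (D_pd (D_F'_neq jk) hx); congr (_ + _).
rewrite big_split/= opprD addrA; congr (_ + _ - _).
rewrite -[X in _ = X](sum_delta (fun l => f'jk k l x * pd l phi x)) -sumrN.
by apply: eq_bigr => l _; rewrite kj /=; ring.
Qed.

Lemma pd2_Lop kappa j k phi theta : j != k -> Cm 4 chamber phi ->
  chamber theta ->
  pd j (pd j (Lop kappa k phi)) theta =
    kappa / 2 * pd j (pd j (pd k (pd k phi))) theta
    + fjk k j theta * f'jk k j theta * pd j phi theta
    + 2 * f'jk k j theta * pd j (pd j phi) theta
    - \sum_l fjk k l theta * pd j (pd j (pd l phi)) theta
    + (6 - kappa) / (2 * kappa) *
      ((fjk k j theta ^+ 2 * f'jk k j theta - f'jk k j theta ^+ 2) * phi theta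
       + 2 * fjk k j theta * f'jk k j theta * pd j phi theta
       + F' k theta * pd j (pd j phi) theta).
Proof.
move=> jk C ht; have C3 := Cm_le (leqnSn 3) C.
have C2 := Cm_le (leqnSn 2) C3; have C1 := Cm_le (leqnSn 1) C2.
rewrite (pd_chamber j (fun x => D_pd (D_Lop_neq kappa jk C3) (theta := x)) ht).
have kj : (k == j) = false by rewrite eq_sym (negbTE jk).
have H := D_add (D_sub (D_add
     (D_scale (kappa / 2) (Cm_D j (Cm_pd j (Cm_pd k (Cm_pd k C)))))
     (D_mul (D_f'jk j k j) (Cm_D j (Cm_pd j C2))))
    (D_sum predT (fun l => D_mul (D_fjk j k l) (Cm_D j (Cm_pd j (Cm_pd l C3))))))
  (D_scale ((6 - kappa) / (2 * kappa))
     (D_add (D_mul (D_mul (D_fjk j k j) (D_f'jk j k j)) (Cm_D j C1))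
            (D_mul (D_F'_neq jk) (Cm_D j (Cm_pd j C2))))).
rewrite (D_pd H ht) kj eqxx big_split/=.
rewrite [X in _ - (X + _)](_ : _ = - (f'jk k j theta * pd j (pd j phi) theta)).
  move: (\sum_l fjk k l theta * pd j (pd j (pd l phi)) theta) => S.
  move: (pd j (pd j (pd k (pd k phi))) theta) (pd j (pd j phi) theta).
  move: (pd j phi theta) (phi theta) (F' k theta) => p1 p0 F'k p4 p2.
  ring.
rewrite -(sum_delta (fun l => f'jk k l theta * pd j (pd l phi) theta)) -sumrN.
by apply: eq_bigr => l _; ring.
Qed.

(** This is the first-order part of L_j acting on L_k phi, up to sign. Differentiating functions of
    theta_k - theta_l along the field with components f_jm gives the factors f_jk - f_jl. *)
Lemma sum_fjk_pd_Lop kappa j k phi theta : Cm 3 chamber phi ->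
  chamber theta ->
  \sum_m fjk j m theta * pd m (Lop kappa k phi) theta =
    kappa / 2 * (\sum_m fjk j m theta * pd m (pd k (pd k phi)) theta)
    - \sum_l f'jk k l theta * (fjk j k theta - fjk j l theta) * pd l phi theta
    - \sum_m \sum_l fjk j m theta * fjk k l theta * pd m (pd l phi) theta
    + (6 - kappa) / (2 * kappa) * (F' k theta *
        (\sum_m fjk j m theta * pd m phi theta)
        - phi theta * \sum_l fjk k l theta * f'jk k l theta *
            (fjk j k theta - fjk j l theta)).
Proof.
move=> C ht.
have delta (g : 'I_n -> R) : \sum_m fjk j m theta *
    (\sum_l g l * ((k == m)%:R - (l == m)%:R)) =
    \sum_l g l * (fjk j k theta - fjk j l theta).
  under eq_bigr do rewrite mulr_sumr.
  rewrite exchange_big; apply: eq_bigr => l _ /=.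
  rewrite -(sum_delta (fjk j ^~ theta) k) -(sum_delta (fjk j ^~ theta) l).
  rewrite -sumrB mulr_sumr; apply: eq_bigr => m _.
  by rewrite ![_ == m]eq_sym; ring.
under eq_bigr do rewrite (D_pd (D_Lop kappa _ k C) ht).
pose g1 l := f'jk k l theta * pd l phi theta.
pose g2 l := - (fjk k l theta * f'jk k l theta).
transitivity (\sum_m (kappa / 2 * (fjk j m theta * pd m (pd k (pd k phi)) theta)
    - fjk j m theta * (\sum_l g1 l * ((k == m)%:R - (l == m)%:R))
    - \sum_l fjk j m theta * fjk k l theta * pd m (pd l phi) theta
    + (6 - kappa) / (2 * kappa) * (F' k theta * (fjk j m theta * pd m phi theta)
      + phi theta * (fjk j m theta *
         (\sum_l g2 l * ((k == m)%:R - (l == m)%:R)))))).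
  apply: eq_bigr => m _; rewrite big_split/=.
  have -> : \sum_l f'jk k l theta * ((k == m)%:R - (l == m)%:R) * pd l phi theta =
      \sum_l g1 l * ((k == m)%:R - (l == m)%:R).
    by apply: eq_bigr => l _; rewrite /g1 mulrAC.
  have -> : \sum_l fjk j m theta * fjk k l theta * pd m (pd l phi) theta =
      fjk j m theta * \sum_l fjk k l theta * pd m (pd l phi) theta.
    by rewrite mulr_sumr; apply: eq_bigr => l _; rewrite mulrA.
  move: (\sum_l _) (\sum_l _) (\sum_l _) => S1 S2 S3.
  move: (pd m (pd k (pd k phi)) theta) (pd m phi theta) (phi theta).
  move: (F' k theta) (fjk j m theta) => F'k fjm p3 p1 p0.
  ring.
rewrite !big_split/= !sumrN -!mulr_sumr big_split/= -!mulr_sumr !delta.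
congr (_ - _ - _ + _ * (_ + _)).
  by apply: eq_bigr => l _; rewrite /g1; ring.
rewrite -mulrN -sumrN; congr (_ * _); apply: eq_bigr => l _.
by rewrite /g2; ring.
Qed.

(** In 2 f' = - (1 + f^2) the 1 is replaced by the cyclic sum, after which the right side
    factors. *)
Lemma f'jk_cyclic j k l theta : chamber theta -> j != k -> k != l -> j != l ->
  f'jk j k theta = - (fjk j k theta + fjk k l theta) *
    (fjk j k theta + fjk l j theta) / 2.
Proof.
move=> ht jk kl jl; rewrite f'jkE// !mulNr; congr (- (_ / 2)).
rewrite -[in LHS](fjk_cyclic ht jk kl jl); ring.
Qed.

(** For distinct indices put a = f_jk, b = f_kl, c = f_lj. By [f'jk_cyclic] the three terms are (a +
    b)(b + c)(c + a) times -1/2, -1/2 and 1. If l is j or k, the vanishing diagonal values leave 3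
    f_jk f'_jk. *)
Lemma gradient_coef j k l theta : chamber theta -> j != k ->
  f'jk k l theta * (fjk j k theta - fjk j l theta)
  - f'jk j l theta * (fjk k j theta - fjk k l theta)
  + 2 * f'jk j k theta * (fjk j l theta - fjk k l theta) =
  3 * (fjk j k theta * f'jk j k theta) * ((l == j)%:R + (l == k)%:R).
Proof.
move=> ht jk; have [->|lj] := eqVneq l j.
  rewrite (negbTE jk) !fjk_diag f'jk_diag (fjkC k j) (f'jkC k j) /=; ring.
have [->|lk] := eqVneq l k.
  rewrite !fjk_diag f'jk_diag (fjkC k j) /=; ring.
have jl : j != l by rewrite eq_sym.
have kl : k != l by rewrite eq_sym.
rewrite (f'jk_cyclic ht jk kl jl) (f'jk_cyclic ht kl lj) 1?eq_sym//.
rewrite (f'jkC j l) (f'jk_cyclic ht lj jk lk).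
by rewrite (fjkC j l) (fjkC k j) /=; field.
Qed.

(** With the same a, b, c, both sides equal (a + b)(b + c)(c + a)(c - b)/2 for distinct indices; the
    Kronecker terms correct l = j and l = k. *)
Lemma potential_coef j k l theta : chamber theta -> j != k ->
  fjk k l theta * f'jk k l theta * (fjk j k theta - fjk j l theta)
  - fjk j l theta * f'jk j l theta * (fjk k j theta - fjk k l theta) =
  2 * f'jk j k theta * (f'jk j l theta - f'jk k l theta)
  + (2 * f'jk j k theta ^+ 2 - fjk j k theta ^+ 2 * f'jk j k theta)
    * ((l == j)%:R - (l == k)%:R).
Proof.
move=> ht jk; have [->|lj] := eqVneq l j.
  rewrite (negbTE jk) !fjk_diag f'jk_diag (fjkC k j) (f'jkC k j) /=; ring.
have [->|lk] := eqVneq l k.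
  rewrite !fjk_diag f'jk_diag (fjkC k j) /=; ring.
have jl : j != l by rewrite eq_sym.
have kl : k != l by rewrite eq_sym.
rewrite (f'jk_cyclic ht jk kl jl) (f'jk_cyclic ht kl lj) 1?eq_sym//.
rewrite (f'jkC j l) (f'jk_cyclic ht lj jk lk).
by rewrite (fjkC j l) (fjkC k j) /=; field.
Qed.

Lemma gradient_sum phi j k theta : chamber theta -> j != k ->
  \sum_l f'jk k l theta * (fjk j k theta - fjk j l theta) * pd l phi theta =
  \sum_l f'jk j l theta * (fjk k j theta - fjk k l theta) * pd l phi theta
  - 2 * f'jk j k theta * (\sum_l fjk j l theta * pd l phi theta
                          - \sum_l fjk k l theta * pd l phi theta)
  + 3 * (fjk j k theta * f'jk j k theta) * (pd j phi theta + pd k phi theta).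
Proof.
move=> ht jk.
rewrite -(sum_delta (fun l => pd l phi theta) j).
rewrite -(sum_delta (fun l => pd l phi theta) k).
rewrite -big_split/= -sumrB !mulr_sumr -sumrB -big_split/=.
apply: eq_bigr => l _; have E := gradient_coef l ht jk.
rewrite (_ : f'jk k l theta * _ =
  f'jk j l theta * (fjk k j theta - fjk k l theta)
  - 2 * f'jk j k theta * (fjk j l theta - fjk k l theta)
  + 3 * (fjk j k theta * f'jk j k theta) * ((l == j)%:R + (l == k)%:R)).
  move: (pd l phi theta) => p; ring.
by rewrite -E; ring.
Qed.

Lemma potential_sum j k theta : chamber theta -> j != k ->
  \sum_l fjk k l theta * f'jk k l theta * (fjk j k theta - fjk j l theta) =
  \sum_l fjk j l theta * f'jk j l theta * (fjk k j theta - fjk k l theta)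
  + 2 * f'jk j k theta * (F' j theta - F' k theta).
Proof.
move=> ht jk; rewrite !F'E.
pose c := 2 * f'jk j k theta ^+ 2 - fjk j k theta ^+ 2 * f'jk j k theta.
(* The corrections at l = j and l = k are opposite, so they may be added to the sum for free and the
   identity checked term by term. *)
have c0 : c * (\sum_(l < n) (l == j)%:R - \sum_(l < n) (l == k)%:R) = 0.
  by rewrite !sum_delta1 subrr mulr0.
rewrite -[RHS]addr0 -[X in _ = _ + X]c0.
rewrite -!sumrB !mulr_sumr -!big_split/=; apply: eq_bigr => l _.
by rewrite -[LHS](subrK (fjk j l theta * f'jk j l theta *
  (fjk k j theta - fjk k l theta))) (potential_coef l ht jk) /c; ring.
Qed.

(** The second-order part kappa f'_jk (d_j^2 - d_k^2) comes from kappa/2 d_j^2 meeting the drift of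
    L_k, and conversely. [gradient_sum] and [potential_sum] settle orders one and zero. *)
Lemma commutator_Lop kappa j k : kappa != 0 -> j != k ->
  op_eq 4 (commutator (Lop kappa j) (Lop kappa k))
    (fun phi theta => 1 / sin ((theta 0 j - theta 0 k) / 2) ^+ 2 *
       (Lop kappa k phi theta - Lop kappa j phi theta)).
Proof.
move=> k0 jk phi C theta ht; have kj : k != j by rewrite eq_sym.
have C3 := Cm_le (leqnSn 3) C.
have C2 := Cm_le (leqnSn 2) C3.
have third a b : \sum_l fjk a l theta * pd b (pd b (pd l phi)) theta =
    \sum_l fjk a l theta * pd l (pd b (pd b phi)) theta.
  by apply: eq_bigr => l _; rewrite pd_pd2C.
(* The product of the two drifts has the same second-order part in either order. *)
have second : \sum_m \sum_l fjk k m theta * fjk j l theta * pd m (pd l phi) theta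
    = \sum_m \sum_l fjk j m theta * fjk k l theta * pd m (pd l phi) theta.
  rewrite exchange_big; apply: eq_bigr => m _; apply: eq_bigr => l _ /=.
  by rewrite (pdC l m C2 ht); ring.
(* On the terms themselves, field would compare iterated derivatives up to
   conversion, so the identity is proved for variables. *)
have alg (LjLk LkLj Lj Lk ppj ppk Vj Vk q q' p0 pj pk pjj pkk T1 T1' T2 T2' S S'
    Wj Wk Aj Ak F'j F'k Z1 Z2 f1 f2 d1 d2 s : R) (c := (6 - kappa) / (2 * kappa)) :
    LjLk = kappa / 2 * ppj - Vj + c * F'j * Lk ->
    LkLj = kappa / 2 * ppk - Vk + c * F'k * Lj ->
    Lj = kappa / 2 * pjj - Aj + c * F'j * p0 ->
    Lk = kappa / 2 * pkk - Ak + c * F'k * p0 ->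
    ppj = kappa / 2 * q + f2 * d2 * pj + 2 * d2 * pjj - T1
      + c * ((f2 ^+ 2 * d2 - d2 ^+ 2) * p0 + 2 * f2 * d2 * pj + F'k * pjj) ->
    ppk = kappa / 2 * q' + f1 * d1 * pk + 2 * d1 * pkk - T2
      + c * ((f1 ^+ 2 * d1 - d1 ^+ 2) * p0 + 2 * f1 * d1 * pk + F'j * pkk) ->
    Vj = kappa / 2 * T2' - Wj - S + c * (F'k * Aj - p0 * Z1) ->
    Vk = kappa / 2 * T1' - Wk - S' + c * (F'j * Ak - p0 * Z2) ->
    q = q' -> T1 = T1' -> T2 = T2' -> S' = S ->
    Wj = Wk - 2 * d1 * (Aj - Ak) + 3 * (f1 * d1) * (pj + pk) ->
    Z1 = Z2 + 2 * d1 * (F'j - F'k) ->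
    f2 = - f1 -> d2 = d1 -> s = - 2 * d1 ->
    LjLk - LkLj = s * (Lk - Lj).
  move=> -> -> -> -> -> -> -> -> -> -> -> -> -> -> -> -> ->.
  by rewrite /c; field.
exact: (alg _ _ _ _ _ _ _ _ _ _ _ _ _ _ _ _ _ _ _ _ _ _ _ _ _ _ _ _ _ _ _ _ _ _
  (LopE kappa j (Lop kappa k phi) theta) (LopE kappa k (Lop kappa j phi) theta)
  (LopE kappa j phi theta) (LopE kappa k phi theta)
  (pd2_Lop kappa jk C ht) (pd2_Lop kappa kj C ht)
  (sum_fjk_pd_Lop kappa j k C3 ht) (sum_fjk_pd_Lop kappa k j C3 ht)
  (pd2_pd2C j k C ht) (third k j) (third j k) second
  (gradient_sum phi ht jk) (potential_sum ht jk)
  (fjkC k j theta) (f'jkC k j theta) (inv_sin2E j k theta)).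
Qed.

End Commutator.

(** * Joint eigenfunctions and the theorem *)

Section PartitionFunctions.
Context {R : realType} {n : nat}.
Notation fn := ('rV[R]_n -> R).
Implicit Types (theta : 'rV[R]_n) (phi psi Z : fn) (kappa h : R) (j k : 'I_n).

(** The eigenvalue equations hold on the chamber only, while the operators act on functions on the
    whole space; this lemma permits replacing [Lop kappa k Z] by [h * Z] under another operator. *)
Lemma Lop_chamber kappa j phi psi theta :
  (forall x, chamber x -> phi x = psi x) -> chamber theta ->
  Lop kappa j phi theta = Lop kappa j psi theta.
Proof.
move=> E ht; have E1 k x : chamber x -> pd k phi x = pd k psi x.
  exact: pd_chamber.
rewrite !LopE (pd_chamber j (E1 j) ht) (E _ ht).
by congr (_ - _ + _); apply: eq_bigr => k _; rewrite E1.
Qed.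

Lemma Lop_scale kappa j (c : R) phi theta : Cm 2 chamber phi ->
  chamber theta ->
  Lop kappa j (fun x => c * phi x) theta = c * Lop kappa j phi theta.
Proof.
move=> C ht; have C1 := Cm_le (leqnSn 1) C.
have E1 k x : chamber x -> pd k (fun y => c * phi y) x = c * pd k phi x.
  by move=> hx; rewrite (D_pd (D_scale c (Cm_D k C1)) hx).
rewrite !LopE (pd_chamber j (E1 j) ht).
rewrite (D_pd (D_scale c (Cm_D j (Cm_pd j C))) ht).
under eq_bigr do rewrite E1// mulrCA.
rewrite -mulr_sumr; move: (\sum_k _) (pd _ _ _) => S p; ring.
Qed.

Lemma Lop_partition_function kappa h Z j k theta :
  partition_function kappa h Z -> chamber theta ->
  Lop kappa j (Lop kappa k Z) theta = h * (h * Z theta).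
Proof.
move=> [C _ LZ] ht; rewrite (Lop_chamber kappa j (LZ k) ht).
by rewrite Lop_scale// LZ.
Qed.

End PartitionFunctions.

Theorem theorem1p5 (R : realType) (n : nat) (kappa h : R) (Z : 'rV[R]_n -> R)
    (n_ge2 : (2 <= n)%N) (kappa_gt0 : 0 < kappa)
    (Z_pf : partition_function kappa h Z) :
  let Ztilde := fun theta : 'rV[R]_n => (Phi (1 / kappa) theta)^-1 * Z theta in
  let conjL := fun j : 'I_n =>
    op_conj (fun theta => (Phi (1 / kappa) theta)^-1)
            (Lop kappa j) (Phi (1 / kappa)) in
  ([/\ forall (j : 'I_n) (theta : 'rV[R]_n), chamber theta ->
         conjL j Ztilde theta = h * Ztilde theta,
       forall j : 'I_n, op_eq 2 (conjL j) (Lop_conj kappa j) &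
       op_eq 2 (op_conj (Phi (- (1 / kappa))) (Lsum kappa) (Phi (1 / kappa)))
         (fun (phi : 'rV[R]_n -> R) theta => kappa * Hop (8 / kappa) phi theta +
            n%:R * (n%:R ^+ 2 - 1) / (6 * kappa) * phi theta)])
  /\
  (forall j k : 'I_n, j != k ->
     op_eq 4 (commutator (Lop kappa j) (Lop kappa k))
       (fun (phi : 'rV[R]_n -> R) theta => 1 / sin ((theta 0 j - theta 0 k) / 2) ^+ 2 *
          (Lop kappa k phi theta - Lop kappa j phi theta)) /\
     (forall theta : 'rV[R]_n, chamber theta ->
        commutator (Lop kappa j) (Lop kappa k) Z theta =
          1 / sin ((theta 0 j - theta 0 k) / 2) ^+ 2 *
            (Lop kappa k Z theta - Lop kappa j Z theta) /\
        1 / sin ((theta 0 j - theta 0 k) / 2) ^+ 2 *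
            (Lop kappa k Z theta - Lop kappa j Z theta) = 0)).

Proof.
move=> Ztilde conjL; have [C _ LZ] := Z_pf.
have k0 : kappa != 0 by rewrite gt_eqF.
have conj_LopE j phi theta : Cm 2 chamber phi -> chamber theta ->
    conjL j phi theta = Lop_conj kappa j phi theta by exact: op_conj_Lop.
split; first split.
- move=> j theta ht.
  (* Multiplying [Ztilde] by [Phi (1 / kappa)] recovers [Z] on the chamber, where the prefactor is
     positive. *)
  rewrite /conjL /op_conj (Lop_chamber kappa j (psi := Z) _ ht); last first.
    by move=> x hx; rewrite /Ztilde mulVKf// gt_eqF// Phi_gt0.
  by rewrite LZ// /Ztilde mulrCA.
- by move=> j phi Cphi theta ht; exact: conj_LopE.
- move=> phi Cphi theta ht; rewrite -Lsum_conj// /op_conj PhiN /Lsum mulr_sumr.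
  by apply: eq_bigr => j _; rewrite -conj_LopE.
move=> j k jk; split; first exact: commutator_Lop.
(* Both orders of composition give h^2 Z, and L_k Z and L_j Z are both h Z. *)
move=> theta ht; rewrite /commutator !(Lop_partition_function _ _ Z_pf)// !LZ//.
by rewrite !subrr mulr0.
Qed.
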